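(* For integers $d\ge 1$ and $L\ge 2$, let $U$ be the disjoint union of blocks $U_1,\dots,U_d$, each of size $L$, and let $$\mathcal F_{d,L}=\bigl\{\{x_1,\ldots,x_d\}: x_i\in U_i\text{ for every } i=1,\dots,d\bigr\}.$$ Then: (1) The uniform probability measure on $\mathcal F_{d,L}$ is $L$-spread, and $\mathrm{VC}(\mathcal F_{d,L})=d$. (2) There are absolute constants $0<c_1\le c_2$ such that, for all integers $d\ge1$, $L\ge2$ and all $0<\varepsilon\le 1/2$ with $L^{-1}\log((d+1)/\varepsilon)\le 1$, the least $p\in[0,1]$ for which $W\sim\mathrm{Bin}(U,p)$ satisfies $\Pr_W[\exists S\in\mathcal F_{d,L}:S\subseteq W]\ge 1-\varepsilon$ lies between $\frac{c_1}{L}\log\frac{d+1}{\varepsilon}$ and $\frac{c_2}{L}\log\frac{d+1}{\varepsilon}$. (3) $q(\mathcal F_{d,L})=q_f(\mathcal F_{d,L})=2^{-1/d}/L$. (4) Taking $L=d$ and letting $d\to\infty$, $\;p_c(\mathcal F_{d,d})/q(\mathcal F_{d,d})=(1+o(1))\log d$.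
   Context: $\log$ is the natural logarithm. $W\sim\mathrm{Bin}(U,p)$ means that each point of the finite set $U$ is included in the random set $W$ independently with probability $p$. A probability measure $\mu$ on $2^U$ is $k$-spread ($k\ge1$ real) if, for $S\sim\mu$, $\Pr_S[T\subseteq S]\le k^{-|T|}$ for every nonempty $T\subseteq U$. A set $D\subseteq U$ is shattered by $\mathcal F$ if $\{S\cap D:S\in\mathcal F\}=2^D$; $\mathrm{VC}(\mathcal F)$ is the largest size of a set shattered by $\mathcal F$. For nonempty $\mathcal F\subseteq 2^U\setminus\{\varnothing\}$: the threshold $p_c(\mathcal F)$ is the unique $p\in[0,1]$ with $\Pr_W[\exists S\in\mathcal F:S\subseteq W]=1/2$ for $W\sim\mathrm{Bin}(U,p)$. A family $\mathcal G\subseteq 2^U$ covers $\mathcal F$ if every $S\in\mathcal F$ contains some $T\in\mathcal G$ as a subset; the expectation threshold $q(\mathcal F)$ is the largest $p\in[0,1]$ for which some $\mathcal G$ covering $\mathcal F$ satisfies $\sum_{T\in\mathcal G}p^{|T|}\le\frac12$ (with $p^0=1$). A function $\lambda:2^U\to[0,\infty)$ is a fractional cover of $\mathcal F$ if $\sum_{T\subseteq S}\lambda(T)\ge1$ for every $S\in\mathcal F$; the fractional expectation threshold $q_f(\mathcal F)$ is the largest $p\in[0,1]$ for which some fractional cover $\lambda$ satisfies $\sum_{T\subseteq U}\lambda(T)p^{|T|}\le\frac12$. *)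

(* Defs.v *)
From HB Require Import structures.
From mathcomp Require Import all_boot all_order all_algebra.
From mathcomp Require Import all_classical all_reals all_analysis.

Set Implicit Arguments.
Unset Strict Implicit.
Unset Printing Implicit Defensive.

Import Order.TTheory GRing.Theory Num.Theory.
Import numFieldNormedType.Exports.

Local Open Scope ring_scope.

Section Probability.
Context {R : realType} {U : finType}.
Implicit Types (mu : {set U} -> R) (F : {set {set U}}) (p k : R).

(* Measures on the finite set 2^U are given by their mass functions. *)
Definition is_prob mu : Prop :=
  (forall S, 0 <= mu S) /\ \sum_(S : {set U}) mu S = 1.

Definition Pr mu (E : pred {set U}) : R := \sum_(S : {set U} | E S) mu S.

Definition bin_subset p : {set U} -> R :=
  fun W => \prod_(u : U) (if u \in W then p else 1 - p).

Definition uniform F : {set U} -> R :=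
  fun S => if S \in F then #|F|%:R^-1 else 0.

Definition spread k mu : Prop :=
  [/\ is_prob mu, 1 <= k &
      forall T : {set U}, T != finset.set0 ->
        Pr mu (fun S => T \subset S) <= k ^- #|T|].

Definition prob_contains F p : R :=
  Pr (bin_subset p) (fun W => [exists S in F, S \subset W]).

End Probability.

Section VCDimension.
Context {U : finType}.
Implicit Types (F : {set {set U}}) (D : {set U}).

Definition shattered F D : bool :=
  [set S :&: D | S in F]%SET == powerset D.

Definition VC F : nat := \max_(D : {set U} | shattered F D) #|D|.

End VCDimension.

(* The three operators below return 0 when there is no least element, no
   largest element, or not exactly one element, respectively. *)
Definition least {R : realType} (A : set R) : R :=
  xget 0 [set p | A p /\ forall r, A r -> p <= r]%classic.

Definition largest {R : realType} (A : set R) : R :=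
  xget 0 [set p | A p /\ forall r, A r -> r <= p]%classic.

Definition the_unique {R : realType} (A : set R) : R :=
  xget 0 [set p | A p /\ forall r, A r -> r = p]%classic.

Section Thresholds.
Context (R : realType) {U : finType}.
Implicit Types (F G : {set {set U}}) (lam : {set U} -> R) (p eps : R).

Definition p_c F : R :=
  the_unique [set p : R | 0 <= p <= 1 /\ prob_contains F p = 2^-1]%classic.

Definition least_p eps F : R :=
  least [set p : R | 0 <= p <= 1 /\ 1 - eps <= prob_contains F p]%classic.

Definition covers G F : Prop :=
  forall S, S \in F -> exists2 T, T \in G & T \subset S.

Definition q F : R :=
  largest [set p : R | 0 <= p <= 1 /\
    exists2 G, covers G F & \sum_(T in G) p ^+ #|T| <= 2^-1]%classic.

Definition fractional_cover lam F : Prop :=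
  (forall T, 0 <= lam T) /\
  forall S, S \in F -> 1 <= \sum_(T : {set U} | T \subset S) lam T.

Definition q_f F : R :=
  largest [set p : R | 0 <= p <= 1 /\
    exists2 lam, fractional_cover lam F &
      \sum_(T : {set U}) lam T * p ^+ #|T| <= 2^-1]%classic.

End Thresholds.

(* The disjoint union of d blocks of size L is {0..d-1} x {0..L-1}, whose
   i-th block consists of the pairs with first component i. *)
Definition block (d L : nat) (i : 'I_d) : {set 'I_d * 'I_L} :=
  [set u | u.1 == i]%SET.

Definition transversals (d L : nat) : {set {set 'I_d * 'I_L}} :=
  [set [set x i | i : 'I_d] |
    x : {ffun 'I_d -> 'I_d * 'I_L} & [forall i, x i \in block L i]]%SET.

(* Main.v *)
(** A random set W contains a transversal iff it meets every block, so the
containment probability is (1 - (1 - p)^L)^d. Inverting it, the p at which it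
equals t is 1 - m^(1/L), where m = 1 - t^(1/d) lies between (1 - t)/d and
(1 - t)/(t d) by Bernoulli's inequality; so p is about ln(1/m)/L.
For the expectation thresholds, the family itself is a cover of cost (L p)^d,
while averaging a fractional cover over the L-spread uniform measure shows that
its cost is at least min(1, (L p)^d). *)

Require Import Defs.
From HB Require Import structures.
From mathcomp Require Import all_boot all_order all_algebra.
From mathcomp Require Import all_classical all_reals all_analysis.
From mathcomp Require Import ring lra.

Set Implicit Arguments.
Unset Strict Implicit.
Unset Printing Implicit Defensive.

Import Order.TTheory GRing.Theory Num.Theory.
Import numFieldNormedType.Exports.

Local Open Scope classical_set_scope.
Local Open Scope ring_scope.

(** * Evaluation of the extremum operators *)

(** An exhibited extremum is unique by antisymmetry, so [xget] returns it and not the default value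
    0. *)
Lemma least_eq (R : realType) (A : set R) (p : R) :
  A p -> (forall r, A r -> p <= r) -> least A = p.
Proof.
move=> Ap pmin; apply: xget_unique => // r [Ar rmin].
by apply/eqP; rewrite eq_le rmin // pmin.
Qed.

Lemma largest_eq (R : realType) (A : set R) (p : R) :
  A p -> (forall r, A r -> r <= p) -> largest A = p.
Proof.
move=> Ap pmax; apply: xget_unique => // r [Ar rmax].
by apply/eqP; rewrite eq_le pmax // rmax.
Qed.

(** * Combinatorics of transversals and blocks *)

Section Transversals.
Context {d L : nat}.
Implicit Types (f : {ffun 'I_d -> 'I_L}) (S T W : {set 'I_d * 'I_L}).

(** Transversals are exactly the graphs of functions, each of a unique one, so sums and counts over
    the family become sums and counts over functions. *)
Definition graph f : {set 'I_d * 'I_L} := [set (i, f i) | i : 'I_d]%SET.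

Lemma mem_graph f u : (u \in graph f) = (f u.1 == u.2).
Proof.
apply/imsetP/eqP => [[i _ ->] //|fu].
by exists u.1; rewrite // fu -surjective_pairing.
Qed.

Lemma graph_inj : injective graph.
Proof.
move=> f g fg; apply/ffunP => i.
have : (i, f i) \in graph g by rewrite -fg mem_graph.
by rewrite mem_graph => /eqP.
Qed.

Lemma card_graph f : #|graph f| = d.
Proof. by rewrite card_imset ?card_ord // => i j []. Qed.

Lemma graph_transversal f : graph f \in transversals d L.
Proof.
apply/imsetP; exists [ffun i => (i, f i)].
  by rewrite inE; apply/forallP => i; rewrite ffunE inE.
by apply: eq_imset => i; rewrite ffunE.
Qed.

Lemma transversalsE : transversals d L = [set graph f | f : {ffun 'I_d -> 'I_L}]%SET.
Proof.
apply/setP => S; apply/idP/imsetP => [|[f _ ->]]; last exact: graph_transversal.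
case/imsetP=> x; rewrite inE => /forallP xB ->.
exists [ffun i => (x i).2] => //; apply: eq_imset => i.
by have := xB i; rewrite inE ffunE => /eqP {2}<-; rewrite -surjective_pairing.
Qed.

Lemma transversalP S :
  reflect (exists f, S = graph f) (S \in transversals d L).
Proof.
rewrite transversalsE.
by apply: (iffP imsetP) => [[f _ ->]|[f ->]]; exists f.
Qed.

Lemma card_transversals : #|transversals d L| = (L ^ d)%N.
Proof.
by rewrite transversalsE card_imset ?card_ffun ?card_ord //; apply: graph_inj.
Qed.

Lemma big_transversals (R : nmodType) (P : pred {set 'I_d * 'I_L})
    (F : {set 'I_d * 'I_L} -> R) :
  \sum_(S in transversals d L | P S) F S = \sum_(f | P (graph f)) F (graph f).
Proof.
rewrite transversalsE big_mkcondr big_imset /=; last by move=> f g _ _ /graph_inj.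
by rewrite [RHS]big_mkcond.
Qed.

Definition slice W (i : 'I_d) : {set 'I_L} := [set l | (i, l) \in W]%SET.

(** A subset of the disjoint union amounts to one independent choice of a subset in each block; this
    is the change of variables that factors the containment probability. *)
Lemma slice_bij : bijective (fun W => [ffun i => slice W i]).
Proof.
exists (fun h : {ffun 'I_d -> {set 'I_L}} => [set u | u.2 \in h u.1]%SET) => [W|h].
  by apply/setP => -[i l]; rewrite !inE ffunE inE.
by apply/ffunP => i; apply/setP => l; rewrite ffunE !inE.
Qed.

Lemma card_slices W : (\sum_i #|slice W i| = #|W|)%N.
Proof.
rewrite -sum1_card (eq_bigr (fun i => \sum_(l in slice W i) 1)%N); last first.
  by move=> i _; rewrite sum1_card.
by rewrite pair_big_dep /=; apply: eq_bigl => -[i l]; rewrite inE.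
Qed.

Lemma contains_transversalE W :
  [exists S in transversals d L, S \subset W]
    = [forall i, slice W i != finset.set0].
Proof.
apply/exists_inP/forallP => [[_ /transversalP[f ->] /fintype.subsetP fW] i|W0].
  by apply/set0Pn; exists (f i); rewrite inE fW // mem_graph.
have {}W0 i : exists l, l \in slice W i by apply/set0Pn.
exists (graph [ffun i => xchoose (W0 i)]); first exact: graph_transversal.
apply/fintype.subsetP => -[i l]; rewrite mem_graph ffunE /= => /eqP <-.
by have := xchooseP (W0 i); rewrite inE.
Qed.

(** Both sides are products over the blocks. Where [T] has no point, there are at most [L] values
    for [f i]; where it has one, at most one value; where it has more, none. After multiplication by
    [L ^ #|slice T i|] each block contributes at most [L]. *)
Lemma card_graphs_above T :
  (#|[pred f | T \subset graph f]| * L ^ #|T| <= L ^ d)%N.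
Proof.
pose Q i : pred 'I_L := [pred l | slice T i \subset [set l]%SET].
have -> : #|[pred f | T \subset graph f]| = #|family Q|.
  apply: eq_card => f; rewrite !inE; apply/fintype.subsetP/forallP => [Tf i|Tf [i l] uT].
    by rewrite inE; apply/fintype.subsetP => l; rewrite !inE => /Tf; rewrite mem_graph eq_sym.
  have /fintype.subsetP/(_ l) := Tf i; rewrite !inE mem_graph eq_sym; exact.
rewrite card_family -card_slices expn_sum.
have -> : foldr muln 1%N [seq #|Q x| | x : 'I_d] = (\prod_(i < d) #|Q i|)%N.
  by rewrite foldrE big_image.
rewrite -big_split -[in X in (_ <= L ^ X)%N](card_ord d) -prod_nat_const /=.
apply: leq_prod => i _.
have [T0|[l lT]] := set_0Vmem (slice T i).
  by rewrite T0 cards0 muln1 -[leqRHS]card_ord max_card.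
have QI : Q i \subset [set l]%SET.
  by apply/fintype.subsetP => m; rewrite !inE => /fintype.subsetP/(_ l lT); rewrite inE eq_sym.
(* Two points of [T] in the same block make [Q i] empty and the product zero; an admissible value
   [m] forces the slice to have at most one point. *)
have [m|Q0] := pickP (Q i); last by rewrite eq_card0 // mul0n.
move=> /subset_leq_card; rewrite cards1 => T1.
have Q1 := subset_leq_card QI; rewrite cards1 in Q1.
have L_gt0 : (0 < L)%N := leq_ltn_trans (leq0n l) (ltn_ord l).
by rewrite -[leqRHS]mul1n leq_mul // -[leqRHS]expn1 leq_pexp2l.
Qed.

End Transversals.

(** * Spreadness of the uniform measure, and the probability of containing a transversal *)

Section Spread.
Context (R : realType) (d L : nat).
Implicit Types (S T W : {set 'I_d * 'I_L}) (p : R).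

Lemma Pr_uniform_transversals (P : pred {set 'I_d * 'I_L}) :
  Pr (uniform (transversals d L) : _ -> R) P
    = #|[pred f : {ffun 'I_d -> 'I_L} | P (graph f)]|%:R / L%:R ^+ d.
Proof.
rewrite /Pr /uniform -big_mkcondr /= (eq_bigl _ _ (fun S => andbC _ _)).
rewrite (big_transversals P (fun=> #|transversals d L|%:R^-1 : R)) card_transversals natrX.
by rewrite mulr_natl -sumr_const; apply: eq_bigl.
Qed.

Lemma is_prob_uniform_transversals : (0 < L)%N ->
  is_prob (uniform (transversals d L) : _ -> R).
Proof.
move=> L_gt0; split=> [S|]; first by rewrite /uniform; case: ifP; rewrite ?invr_ge0.
have := Pr_uniform_transversals xpredT; rewrite /Pr => ->.
have -> : #|[pred f : {ffun 'I_d -> 'I_L} | true]| = (L ^ d)%N.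
  by rewrite -[in RHS](card_ord L) -[in RHS](card_ord d) -card_ffun; apply: eq_card.
by rewrite natrX divff // expf_neq0 // pnatr_eq0 -lt0n.
Qed.

Lemma Pr_uniform_transversals_above T : (0 < L)%N ->
  Pr (uniform (transversals d L) : _ -> R) (fun S => T \subset S) <= L%:R ^- #|T|.
Proof.
move=> L_gt0; have LR_gt0 : 0 < L%:R :> R by rewrite ltr0n.
rewrite Pr_uniform_transversals ler_pdivrMr ?exprn_gt0 // ler_pdivlMl ?exprn_gt0 //.
by rewrite mulrC -!natrX -natrM ler_nat card_graphs_above.
Qed.

Lemma spread_transversals : (0 < L)%N ->
  spread (L%:R : R) (uniform (transversals d L)).
Proof.
move=> L_gt0; split=> [||T _]; first exact: is_prob_uniform_transversals.
  by rewrite ler1n.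
exact: Pr_uniform_transversals_above.
Qed.

Lemma bin_subset_slices p W :
  bin_subset p W = \prod_i bin_subset p (slice W i).
Proof.
rewrite /bin_subset pair_bigA /=; apply: eq_bigr => -[i l] _ /=.
by rewrite inE.
Qed.

Lemma sum_bin_subset (U : finType) p : \sum_(W : {set U}) bin_subset p W = 1.
Proof.
rewrite -(bigA_distr _ _ (fun _ : U => p) (fun=> 1 - p)) /=.
by rewrite big1 // => u _; rewrite addrC subrK.
Qed.

Lemma sum_bin_subset_neq0 (U : finType) p :
  \sum_(W : {set U} | W != finset.set0) bin_subset p W = 1 - (1 - p) ^+ #|U|.
Proof.
have <- : bin_subset p (finset.set0 : {set U}) = (1 - p) ^+ #|U|.
  by rewrite /bin_subset -prodr_const; apply: eq_bigr => u _; rewrite inE.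
by rewrite -(sum_bin_subset U p) [in RHS](bigD1 finset.set0) //= addrC addrK.
Qed.

Lemma prob_contains_transversals p :
  prob_contains (transversals d L) p = (1 - (1 - p) ^+ L) ^+ d.
Proof.
rewrite /prob_contains /Pr (eq_bigl _ _ contains_transversalE).
under eq_bigr do rewrite bin_subset_slices.
have := @sum_bin_subset_neq0 'I_L p; rewrite card_ord => <-.
(* The [d]-th power expands into a sum over all assignments of a nonempty subset to each block, and
   [slice_bij] matches these with the sets [W] that meet every block. *)
rewrite -[in RHS](card_ord d) -prodr_const bigA_distr_big /=.
rewrite [RHS](reindex (fun W => [ffun i => slice W i])) /=; last first.
  exact/onW_bij/slice_bij.
apply: eq_big => W.
  by apply: eq_forallb => i; rewrite ffunE.
by move=> _; apply: eq_bigr => i _; rewrite ffunE.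
Qed.

End Spread.

(** * VC dimension *)

(** A shattered set is itself a trace, hence lies inside a transversal, which has [d] points.
    Conversely any fixed transversal is shattered; the graph of the zero function is taken. *)
Lemma VC_transversals (d L : nat) : (1 < L)%N -> VC (transversals d L) = d.
Proof.
case: L => [|[|L]] // _; apply/eqP; rewrite eqn_leq; apply/andP; split.
  apply/bigmax_leqP => D /eqP shD.
  have : D \in powerset D by rewrite inE.
  rewrite -shD => /imsetP[_ /transversalP[f ->] DE].
  by rewrite DE -[leqRHS](card_graph f) subset_leq_card // finset.subsetIl.
pose z : {ffun 'I_d -> 'I_L.+2} := [ffun=> ord0].
rewrite -[leqLHS](card_graph z); apply: leq_bigmax_cond.
apply/eqP/setP => A; rewrite inE; apply/imsetP/idP => [[S _ ->]|/fintype.subsetP Az].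
  exact: finset.subsetIr.
(* Since a block has at least two points, [ord_max] differs from [ord0], so this graph leaves the
   zero graph exactly in the blocks that [A] misses. *)
pose f : {ffun 'I_d -> 'I_L.+2} := [ffun i => if (i, ord0) \in A then ord0 else ord_max].
exists (graph f); first exact: graph_transversal.
apply/setP => -[i l]; rewrite inE !mem_graph !ffunE /=.
apply/idP/andP => [iA|[]].
  have := Az _ iA; rewrite mem_graph ffunE /= => /eqP l0.
  by rewrite -l0 in iA *; rewrite iA.
by case: ifP => iA /eqP <- //.
Qed.

(** * Expectation threshold and its fractional version *)

Section ExpectationThreshold.
Context (R : realType) (d L : nat).
Hypotheses (d_gt0 : (0 < d)%N) (L_gt1 : (1 < L)%N).
Implicit Types (p : R) (lam : {set 'I_d * 'I_L} -> R).

Let L_gt0 : (0 < L)%N := ltnW L_gt1.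

Lemma Pr_uniform_transversals_above_eq0 (T : {set 'I_d * 'I_L}) : (d < #|T|)%N ->
  Pr (uniform (transversals d L) : _ -> R) (fun S => T \subset S) = 0.
Proof.
move=> dT; rewrite Pr_uniform_transversals eq_card0 ?mul0r // => f.
rewrite !inE; apply/negbTE/negP => /subset_leq_card.
by rewrite card_graph leqNgt dT.
Qed.

(* Averaging the covering inequalities over the uniform measure bounds the cost
   of a fractional cover from below; only sets of size at most [d] matter. *)
Lemma fractional_cover_cost lam p : fractional_cover lam (transversals d L) ->
  0 <= p -> Num.min 1 ((L%:R * p) ^+ d) <= \sum_T lam T * p ^+ #|T|.
Proof.
move=> [lam_ge0 lam_cov] p_ge0.
have LR_gt0 : 0 < L%:R :> R by rewrite ltr0n.
set c := Num.min _ _; set mu := uniform (transversals d L) : _ -> R.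
have [mu_ge0 mu1] : is_prob mu by apply: is_prob_uniform_transversals.
have c_ge0 : 0 <= c by rewrite le_min ler01 exprn_ge0 // mulr_ge0 // ltW.
(* The minimum with 1 handles both regimes: if [L p >= 1] every power is at least 1, and otherwise
   the powers decrease, so exponent [d] gives the smallest. *)
have cE (n : nat) : (n <= d)%N -> c <= (L%:R * p) ^+ n.
  move=> nd; have [Lp1|Lp1] := leP 1 (L%:R * p).
    by rewrite ge_min exprn_ege1.
  rewrite ge_min; apply/orP; right; apply: ler_wiXn2l => //; last exact: ltW.
  by rewrite mulr_ge0 // ltW.
have avg : 1 <= \sum_T lam T * Pr mu (fun S => T \subset S).
  rewrite -mu1; under [leRHS]eq_bigr do rewrite /Pr mulr_sumr.
  rewrite (exchange_big_dep xpredT) //=; apply: ler_sum => S _.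
  rewrite -mulr_suml.
  have [SF|SF] := boolP (S \in transversals d L); last first.
    by rewrite /mu /uniform (negbTE SF) mulr0.
  by rewrite -[leLHS]mul1r ler_wpM2r // lam_cov.
rewrite -[leLHS]mulr1; apply: le_trans (ler_wpM2l c_ge0 avg) _.
rewrite mulr_sumr; apply: ler_sum => T _; rewrite mulrCA ler_wpM2l //.
have [Td|Td] := leqP #|T| d; last first.
  by rewrite Pr_uniform_transversals_above_eq0 // mulr0 exprn_ge0.
apply: le_trans (ler_wpM2l c_ge0 (Pr_uniform_transversals_above R T L_gt0)) _.
by rewrite ler_pdivrMr ?exprn_gt0 // mulrC -exprMn cE // mulrC.
Qed.

(** The solution of [(L p)^d = 1/2], that is, the [p] at which the family, used as its own cover,
    costs one half. *)
Let q0 : R := 2 `^ (- d%:R^-1) / L%:R.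

Lemma q0_pow : (L%:R * q0) ^+ d = 2^-1.
Proof.
rewrite /q0 mulrCA divff ?mulr1 ?pnatr_eq0 -?lt0n //.
rewrite -powR_mulrn ?powR_ge0 // -powRrM mulNr mulVf ?pnatr_eq0 -?lt0n //.
by rewrite powR_inv1.
Qed.

Lemma q0_itv : 0 <= q0 <= 1.
Proof.
have LR_gt0 : 0 < L%:R :> R by rewrite ltr0n.
have q0_ge0 : 0 <= q0 by rewrite divr_ge0 ?powR_ge0 ?ler0n.
have Lq0 : 0 <= L%:R * q0 by rewrite mulr_ge0 // ltW.
rewrite q0_ge0 /=.
have : L%:R * q0 <= 1.
  have : (L%:R * q0) ^+ d <= 1 ^+ d by rewrite q0_pow expr1n; lra.
  by rewrite ler_pXn2r // nnegrE.
rewrite mulrC -ler_pdivlMr // => /le_trans; apply.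
by rewrite div1r invf_le1 // ler1n.
Qed.

(** As 1 exceeds one half, the bound must fall on [(L p)^d], which increases with [p] and equals one
    half at [q0]. *)
Lemma q0_max p : 0 <= p -> Num.min 1 ((L%:R * p) ^+ d) <= 2^-1 -> p <= q0.
Proof.
move=> p_ge0; have LR_gt0 : 0 < L%:R :> R by rewrite ltr0n.
have /andP[q0_ge0 _] := q0_itv.
rewrite ge_min => /orP[|]; first by lra.
rewrite -q0_pow ler_pXn2r // ?nnegrE ?mulr_ge0 ?(ltW LR_gt0) //.
by rewrite ler_pM2l.
Qed.

(** Through indicators, the single cost bound for fractional covers also gives the upper bound on
    [q], and the family itself serves as the optimal cover for both thresholds. *)
Lemma covers_fractional_cover (U : finType) (F G : {set {set U}}) : covers G F ->
  fractional_cover (fun T => (T \in G)%:R : R) F.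
Proof.
move=> GF; split=> [T|S /GF[T TG TS]]; first exact: ler0n.
rewrite (bigD1 T) //= TG lerDl; exact: sumr_ge0.
Qed.

Lemma sum_indicator_cost (U : finType) (G : {set {set U}}) p :
  \sum_T (T \in G)%:R * p ^+ #|T| = \sum_(T in G) p ^+ #|T|.
Proof.
by rewrite [RHS]big_mkcond; apply: eq_bigr => T _; case: ifP; rewrite (mul1r, mul0r).
Qed.

Lemma transversals_cost : \sum_(T in transversals d L) q0 ^+ #|T| = 2^-1.
Proof.
rewrite -q0_pow exprMn -natrX -card_transversals mulr_natl -sumr_const.
by apply: eq_bigr => _ /transversalP[f ->]; rewrite card_graph.
Qed.

Lemma q_transversals : q R (transversals d L) = q0.
Proof.
apply: largest_eq => [|p [/andP[p_ge0 _] [G GF Gp]]].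
  split; first exact: q0_itv.
  by exists (transversals d L); [move=> S SF; exists S | rewrite transversals_cost].
apply: q0_max => //; apply: le_trans Gp; rewrite -sum_indicator_cost.
exact: fractional_cover_cost (covers_fractional_cover GF) p_ge0.
Qed.

Lemma q_f_transversals : q_f R (transversals d L) = q0.
Proof.
apply: largest_eq => [|p [/andP[p_ge0 _] [lam lamF lamp]]].
  split; first exact: q0_itv.
  exists (fun T => (T \in transversals d L)%:R).
    by apply: covers_fractional_cover => S SF; exists S.
  by rewrite sum_indicator_cost transversals_cost.
by apply: q0_max => //; apply: le_trans lamp; apply: fractional_cover_cost.
Qed.

End ExpectationThreshold.

(** The range down to -1 matters: [x] is later taken to be [- miss t] as well as positive. *)
Lemma bernoulli_ineq (R : realDomainType) (x : R) (n : nat) :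
  -1 <= x -> 1 + n%:R * x <= (1 + x) ^+ n.
Proof.
move=> x_ge; elim: n => [|n IH]; first by rewrite mul0r addr0 expr0.
rewrite exprS; have x1 : 0 <= 1 + x by lra.
apply: le_trans (ler_wpM2l x1 IH).
have : 0 <= n%:R * (x * x) by rewrite mulr_ge0 // -expr2 sqr_ge0.
rewrite -natr1; nra.
Qed.

(** * Inverting the containment probability, and the bounds on [least_p] *)

Section ContainmentThreshold.
Context (R : realType) (d L : nat).
Hypotheses (d_gt0 : (0 < d)%N) (L_gt0 : (0 < L)%N).
Implicit Types (t p r : R).

(* The probability that a given block is missed, when all the blocks are hit
   with probability [t]. *)
Definition miss t : R := 1 - t `^ d%:R^-1.

Definition threshold t : R := 1 - miss t `^ L%:R^-1.

Lemma powR_invnK (n : nat) t : (0 < n)%N -> 0 <= t -> (t `^ n%:R^-1) ^+ n = t.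
Proof.
move=> n_gt0 t_ge0; rewrite -powR_mulrn ?powR_ge0 // -powRrM.
by rewrite mulVf ?powRr1 // pnatr_eq0 -lt0n.
Qed.

Lemma miss_pow t : 0 <= t -> (1 - miss t) ^+ d = t.
Proof. by move=> t_ge0; rewrite /miss subKr powR_invnK. Qed.

Lemma miss_bounds t : 0 < t < 1 -> 0 < miss t < 1.
Proof.
move=> /andP[t_gt0 t_lt1]; have s_gt0 : 0 < t `^ d%:R^-1 by rewrite powR_gt0.
suff : t `^ d%:R^-1 < 1 by rewrite /miss; lra.
have := powR_invnK d_gt0 (ltW t_gt0); set s := t `^ _ in s_gt0 * => st.
rewrite ltNge; apply/negP => s1.
by have := exprn_ege1 d s1; rewrite st; lra.
Qed.

(** Bernoulli at [- m], where [m = miss t]: [t = (1 - m)^d >= 1 - d m]. *)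
Lemma le_miss t : 0 < t < 1 -> 1 - t <= d%:R * miss t.
Proof.
move=> t01; have /andP[m_gt0 m_lt1] := miss_bounds t01.
have := @bernoulli_ineq R (- miss t) d; rewrite miss_pow; last by lra.
by move=> /(_ ltac:(lra)); lra.
Qed.

Lemma miss_le t : 0 < t < 1 -> miss t <= 1 - t.
Proof.
move=> t01; have /andP[m_gt0 m_lt1] := miss_bounds t01.
suff : t <= 1 - miss t by lra.
rewrite -{1}(@miss_pow t); last by lra.
by rewrite -[leRHS]expr1 ler_wiXn2l //; lra.
Qed.

(** With [m = miss t], Bernoulli at [m] gives [(1 + d m) t <= (1 + m)^d (1 - m)^d = (1 - m^2)^d <=
    1]. *)
Lemma dmiss_le t : 0 < t < 1 -> d%:R * miss t <= (1 - t) / t.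
Proof.
move=> t01; have /andP[m_gt0 m_lt1] := miss_bounds t01.
have t_gt0 : 0 < t by lra.
have B := @bernoulli_ineq R (miss t) d ltac:(lra).
rewrite ler_pdivlMr //.
suff : (1 + d%:R * miss t) * t <= 1 by lra.
apply: le_trans (ler_wpM2r (ltW t_gt0) B) _.
rewrite -{2}(@miss_pow t) -?exprMn; last by lra.
by apply: exprn_ile1; nra.
Qed.

(** In this form the single inequality [exp y >= 1 + y] bounds the threshold from both sides. *)
Lemma threshold_expR t : 0 < t < 1 ->
  threshold t = 1 - expR (- (- ln (miss t) / L%:R)).
Proof.
move=> /miss_bounds/andP[m_gt0 _].
by rewrite /threshold /powR gt_eqF // mulNr opprK mulrC.
Qed.

Lemma threshold_itv t : 0 < t < 1 -> 0 <= threshold t <= 1.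
Proof.
move=> t01; have /andP[m_gt0 m_lt1] := miss_bounds t01.
have := expR_gt0 (- (- ln (miss t) / L%:R)).
rewrite threshold_expR //.
have : expR (- (- ln (miss t) / L%:R)) <= 1.
  rewrite -expR0 ler_expR oppr_le0 divr_ge0 ?ler0n // oppr_ge0 ln_le0 //.
  exact: ltW.
lra.
Qed.

Lemma prob_contains_threshold t : 0 < t < 1 ->
  prob_contains (transversals d L) (threshold t) = t.
Proof.
move=> t01; have /andP[m_gt0 _] := miss_bounds t01.
by rewrite prob_contains_transversals /threshold subKr powR_invnK ?miss_pow //; lra.
Qed.

(** Powers with positive exponent are strictly increasing on nonnegative reals. Stated as an
    equivalence, this yields minimality for [least_p] and uniqueness for [p_c]. *)
Lemma prob_contains_mono p r : 0 <= p <= 1 -> 0 <= r <= 1 ->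
  (prob_contains (transversals d L) p <= prob_contains (transversals d L) r)
    = (p <= r).
Proof.
move=> /andP[p0 p1] /andP[r0 r1]; rewrite !prob_contains_transversals.
have hit (x : R) : 0 <= x -> x <= 1 -> 1 - (1 - x) ^+ L \is Num.nneg.
  by move=> x0 x1; rewrite nnegrE subr_ge0 exprn_ile1 //; lra.
rewrite ler_pXn2r ?hit // lerD2l lerN2 ler_pXn2r ?nnegrE ?subr_ge0 //.
by rewrite lerD2l lerN2.
Qed.

Lemma least_p_transversals eps : 0 < eps < 1 ->
  least_p eps (transversals d L) = threshold (1 - eps).
Proof.
move=> eps01; have t01 : 0 < 1 - eps < 1 by lra.
apply: least_eq => [|r [r01]].
  by rewrite /= prob_contains_threshold //; split => //; exact: threshold_itv.
by rewrite -{1}(prob_contains_threshold t01) prob_contains_mono ?threshold_itv.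
Qed.

Lemma p_c_transversals : p_c R (transversals d L) = threshold 2^-1.
Proof.
have t01 : 0 < (2^-1 : R) < 1 by lra.
have P := prob_contains_threshold t01; have I := threshold_itv t01.
have uniq r : 0 <= r <= 1 /\ prob_contains (transversals d L) r = 2^-1 ->
    r = threshold 2^-1.
  move=> [r01 rE]; apply/eqP.
  by rewrite eq_le -(prob_contains_mono r01 I) -(prob_contains_mono I r01) P rE lexx.
by apply: xget_unique => [|r [+ _]]; [split | exact: uniq].
Qed.

Lemma threshold_le t : 0 < t < 1 -> threshold t <= - ln (miss t) / L%:R.
Proof.
move=> t01; rewrite threshold_expR //.
by have := expR_ge1Dx (- (- ln (miss t) / L%:R)); lra.
Qed.

(** With [y = z / L], this is [1 - exp (- y) >= 1 - 1 / (1 + y)]. Leaving [z] free below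
    [- ln (miss t)] lets each application insert an explicit logarithm. *)
Lemma threshold_ge t (z : R) : 0 < t < 1 -> 0 <= z <= - ln (miss t) ->
  z / (L%:R + z) <= threshold t.
Proof.
move=> t01 /andP[z_ge0 zx]; have LR_gt0 : 0 < L%:R :> R by rewrite ltr0n.
rewrite threshold_expR //.
apply: (@le_trans _ _ (1 - expR (- (z / L%:R)))); last first.
  by rewrite lerD2l lerN2 ler_expR lerN2 ler_wpM2r // invr_ge0 ltW.
have y_ge0 : 0 <= z / L%:R by rewrite divr_ge0 // ltW.
rewrite expRN.
have -> : z / (L%:R + z) = 1 - (1 + z / L%:R)^-1.
  by field; rewrite !gt_eqF // ltr_wpDr.
rewrite lerD2l lerN2 lef_pV2 ?posrE ?expR_gt0 ?expR_ge1Dx //; lra.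
Qed.

(** With [m = miss (1 - eps)] and [y] the logarithm in the statement, everything reduces to
    [y / 3 <= - ln m <= y]. *)
Lemma least_p_bounds (eps : R) : 0 < eps -> eps <= 2^-1 ->
  L%:R^-1 * ln ((d%:R + 1) / eps) <= 1 ->
  4^-1 / L%:R * ln ((d%:R + 1) / eps) <= least_p eps (transversals d L)
    <= 1 / L%:R * ln ((d%:R + 1) / eps).
Proof.
move=> e_gt0 e_le; set y := ln _; rewrite ler_pdivrMl ?ltr0n // mulr1 => yL.
have e01 : 0 < eps < 1 by lra.
rewrite least_p_transversals //; have t01 : 0 < 1 - eps < 1 by lra.
have LR_gt0 : 0 < L%:R :> R by rewrite ltr0n.
have d_ge1 : 1 <= d%:R :> R by rewrite ler1n.
have /andP[] := miss_bounds t01.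
have := le_miss t01; have := miss_le t01; have := dmiss_le t01.
have := threshold_le t01; have := @threshold_ge (1 - eps) (y / 3) t01.
set m := miss _; rewrite !subKr => T1 T2 A B C m_gt0 m_lt1.
have dm : d%:R * m <= 2 * eps.
  move: A; rewrite ler_pdivlMr; last by lra.
  have : 0 <= d%:R * m by rewrite mulr_ge0 // ltW.
  nra.
have de_gt0 : 0 < (d%:R + 1) / eps by rewrite divr_gt0 //; lra.
have y_ge0 : 0 <= y by apply: ln_ge0; rewrite ler_pdivlMr //; lra.
have mV : - ln m = ln m^-1 by rewrite lnV.
(* Equivalent to [m >= eps / (d + 1)], which follows from [d m >= eps]. *)
have x_le : - ln m <= y.
  rewrite mV ler_ln ?posrE ?invr_gt0 // -[leRHS]invrK.
  by rewrite lef_pV2 ?posrE ?invr_gt0 // invf_div ler_pdivrMr; nra.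
(* Equivalent to [m^3 <= eps / (d + 1)]. The two extra factors absorb a constant: [m <= 1/2] gives
   [m^2 <= 1/4], against [m (d + 1) <= 4 eps]. *)
have x_ge : y / 3 <= - ln m.
  rewrite ler_pdivrMr // mulr_natr mV -lnXn ?invr_gt0 //.
  rewrite ler_ln ?posrE ?exprn_gt0 ?invr_gt0 //.
  rewrite exprVn -[leLHS]invrK lef_pV2 ?posrE ?invr_gt0 ?exprn_gt0 //.
  rewrite invf_div ler_pdivlMr; last by lra.
  have m1 : m * (d%:R + 1) <= 4 * eps by nra.
  have m2 : m ^+ 2 <= 4^-1 by rewrite expr2; nra.
  rewrite exprSr -mulrA; apply: le_trans (ler_pM _ _ m2 m1) _; last by lra.
    exact: sqr_ge0.
  by rewrite mulr_ge0 //; lra.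
apply/andP; split; last first.
  by rewrite div1r mulrC; apply: le_trans T2 _; rewrite ler_wpM2r // invr_ge0 ltW.
apply: le_trans (T1 _); last by apply/andP; split; lra.
rewrite ler_pdivlMr; last by lra.
(* Source of the constant 1/4: the right side is at most [y / 4 + y / 12 = y / 3] because
   [y <= L]. *)
have -> : 4^-1 / L%:R * y * (L%:R + y / 3) = y / 4 + y / 12 * (y / L%:R).
  by field; rewrite gt_eqF.
have : y / L%:R <= 1 by rewrite ler_pdivrMr // mul1r.
nra.
Qed.

End ContainmentThreshold.

(** * Asymptotics of the ratio of thresholds for [L = d] *)

Section ThresholdRatio.
Context (R : realType).

(** Controls the factor that [q] contributes to the ratio; the upper bound is Bernoulli in the form
    [(1 + 1/d)^d >= 2]. *)
Lemma two_root_bounds (d : nat) : (0 < d)%N ->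
  1 <= (2 : R) `^ d%:R^-1 <= 1 + d%:R^-1.
Proof.
move=> d_gt0; have dR_gt0 : 0 < d%:R :> R by rewrite ltr0n.
apply/andP; split.
  by rewrite -{1}(powRr0 (2 : R)) ler_powR ?invr_ge0 ?ler1n // ler0n.
have dV : 0 < d%:R^-1 :> R by rewrite invr_gt0.
have r0 : 0 <= 1 + d%:R^-1 :> R by rewrite addr_ge0 // ltW.
rewrite -(@ler_pXn2r _ d d_gt0) ?nnegrE ?powR_ge0 // powR_invnK //.
have := @bernoulli_ineq R d%:R^-1 d; rewrite mulfV ?gt_eqF //; apply.
by apply: le_trans (ltW dV); rewrite lerN10.
Qed.

(** Comes from the quadratic term of the exponential series at [ln x]; it keeps the error
    [ln^2 d / d] in the ratio bounded. *)
Lemma sqr_ln_le (x : R) : 1 <= x -> ln x ^+ 2 <= 2 * x.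
Proof.
move=> x1; have := @expR_ge1Dxn R (ln x) 1 (ln_ge0 x1).
rewrite lnK ?posrE; last by lra.
by rewrite (_ : 2`! = 2)%N //; lra.
Qed.

(** With [l = ln d] and [c = 2^(1/d)], the ratio is [c * (d * th)], where [d * th] lies between
    [l - 2] and [l + 1] and [c] between 1 and [1 + 1/d]. Hence the ratio differs from [l] by at most
    3. *)
Lemma ratio_bounds (d : nat) : (1 < d)%N ->
  `|p_c R (transversals d d) / q R (transversals d d) / ln d%:R - 1|
    <= 3 / ln d%:R.
Proof.
move=> d_gt1; have d_gt0 := ltnW d_gt1.
have d_ge2 : 2 <= d%:R :> R by rewrite ler_nat.
have dR_gt0 : 0 < d%:R :> R by lra.
rewrite p_c_transversals // q_transversals // powRN.
have t01 : 0 < (2^-1 : R) < 1 by lra.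
set D : R := d%:R in d_ge2 dR_gt0 *; set l := ln D.
have l_gt0 : 0 < l by rewrite ln_gt0 //; lra.
have l_leD : l <= D.
  have := @le_ln1Dx R (D - 1) ltac:(lra).
  by rewrite addrC subrK -/l; lra.
have lD : l ^+ 2 <= 2 * D by apply: sqr_ln_le; lra.
have := miss_le d_gt0 t01; have := dmiss_le d_gt0 t01; have := le_miss d_gt0 t01.
have := threshold_le d d_gt0 t01; have := @threshold_ge R d d d_gt0 d_gt0 2^-1 l t01.
have /andP[m_gt0 m_lt1] := miss_bounds d_gt0 t01.
have /andP[c1 c2] := two_root_bounds d_gt0.
set c := 2 `^ _ in c1 c2 *; set m := miss _ _; rewrite -/D => T1 T2 M1 M2 M3.
set th := threshold _ _ _ in T1 T2 *.
have x_ge : l <= - ln m.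
  rewrite -lnV ?posrE // ler_ln ?posrE ?invr_gt0 // -[leLHS]invrK.
  rewrite lef_pV2 ?posrE ?invr_gt0 // -[leRHS]mul1r ler_pdivlMr // mulrC; lra.
(* At [t = 1/2] one has [d m >= 1/2], and [exp 1 >= 2] replaces the resulting [ln 2] by 1. *)
have x_le : - ln m <= l + 1.
  have -> : l + 1 = ln (D * expR 1) by rewrite lnM ?posrE ?expR_gt0 // expRK.
  rewrite -lnV ?posrE // ler_ln ?posrE ?invr_gt0 ?mulr_gt0 ?expR_gt0 //.
  have e2 := expR_ge1Dx (1 : R).
  rewrite -[leRHS]invrK lef_pV2 ?posrE ?invr_gt0 ?mulr_gt0 ?expR_gt0 //.
  rewrite -[leLHS]mul1r ler_pdivrMr ?mulr_gt0 ?expR_gt0 //; nra.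
have -> : th / (c^-1 / D) / l - 1 = (c * (th * D) - l) / l.
  by field; rewrite !gt_eqF //; lra.
(* From [th >= l / (D + l)]: the product [(l - 2) (D + l)] is at most [D l] because [l^2 <= 2 D]. *)
have {}T1 : l - 2 <= th * D.
  have := T1 ltac:(lra); rewrite ler_pdivrMr; last by lra.
  have : (l - 2) * (D + l) <= D * l by nra.
  have Dl : 0 < D + l by lra.
  move=> A B; rewrite -(ler_pM2r Dl); nra.
have {}T2 : th * D <= l + 1.
  by move: T2; rewrite ler_pdivlMr //; lra.
have Dl : D^-1 * l <= 1 by rewrite ler_pdivrMl // mulr1.
have DV : 0 < D^-1 by rewrite invr_gt0.
have DV1 : D^-1 <= 2^-1 by rewrite lef_pV2 ?posrE //; lra.
have th_ge0 : 0 <= th * D.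
  by rewrite mulr_ge0 ?(ltW dR_gt0) //; have /andP[] := threshold_itv d d_gt0 t01.
rewrite normrM [`|l^-1|]gtr0_norm ?invr_gt0 //.
rewrite ler_pM2r ?invr_gt0 // ler_norml; apply/andP; split; first by nra.
have : c * (th * D) <= (1 + D^-1) * (l + 1) by apply: ler_pM => //; lra.
nra.
Qed.

Lemma cvg_inv_ln : 3 / ln d%:R @[d --> \oo] --> (0 : R).
Proof.
apply/cvgrPdist_le => e e_gt0.
near=> d.
have dE : expR (3 / e) <= d%:R by near: d; exact: nbhs_infty_ger.
have l_ge : 3 / e <= ln d%:R.
  by rewrite -(expRK (3 / e)) ler_ln ?posrE ?expR_gt0 // (lt_le_trans _ dE) ?expR_gt0.
have l_gt0 : 0 < ln d%:R :> R by apply: lt_le_trans l_ge; rewrite divr_gt0.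
rewrite sub0r normrN gtr0_norm ?divr_gt0 //.
by move: l_ge; rewrite !ler_pdivrMr // mulrC.
Unshelve. all: by end_near. Qed.

End ThresholdRatio.

Theorem mainTheorem7 (R : realType) :
  [/\ forall d L : nat, (1 <= d)%N -> (2 <= L)%N ->
        spread (L%:R : R) (uniform (transversals d L)) /\
        VC (transversals d L) = d,
      exists c1 c2 : R, 0 < c1 /\ c1 <= c2 /\
        forall (d L : nat) (eps : R), (1 <= d)%N -> (2 <= L)%N ->
          0 < eps -> eps <= 2^-1 ->
          L%:R^-1 * ln ((d%:R + 1) / eps) <= 1 ->
          c1 / L%:R * ln ((d%:R + 1) / eps)
            <= least_p eps (transversals d L)
            <= c2 / L%:R * ln ((d%:R + 1) / eps),
      forall d L : nat, (1 <= d)%N -> (2 <= L)%N ->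
        q R (transversals d L) = 2 `^ (- d%:R^-1) / L%:R /\
        q_f R (transversals d L) = 2 `^ (- d%:R^-1) / L%:R
    & exists o : nat -> R, o @ \oo --> 0 /\
        forall d : nat, (2 <= d)%N ->
          p_c R (transversals d d) / q R (transversals d d)
            = (1 + o d) * ln d%:R].
Proof.
split.
- move=> d L _ L_gt1; split; first exact/spread_transversals/ltnW.
  exact: VC_transversals.
- exists 4^-1, 1; split; first by lra.
  split=> [|d L eps d_gt0 L_gt1 e_gt0 e_le leL]; first by lra.
  by apply: least_p_bounds => //; exact: ltnW.
- by move=> d L d_gt0 L_gt1; rewrite q_transversals ?q_f_transversals.
(* This error term is the one forced by the required equation; [ratio_bounds] makes it vanish in the
   limit, for [d >= 2], where [ln d] is positive. *)
- pose o (d : nat) : R :=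
    p_c R (transversals d d) / q R (transversals d d) / ln d%:R - 1.
  exists o; split=> [|d d_gt1]; last first.
    have l_neq0 : ln d%:R != 0 :> R by rewrite gt_eqF // ln_gt0 // ltr1n.
    by rewrite /o addrC subrK divfK.
  apply/cvgr0Pnorm_le => e e_gt0.
  have /cvgr0Pnorm_le/(_ e e_gt0) := @cvg_inv_ln R.
  apply: filterS2 (nbhs_infty_gt 1) => d d_gt1 le_e.
  exact: le_trans (ratio_bounds R d_gt1) (le_trans (ler_norm _) le_e).
Qed.
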